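(* Let $k$ be an infinite field of characteristic $p>0$, let $q=p^e>1$ be a power of $p$, and for $i=1,\ldots,5$ let $d_i=k_iq+r_i$ with integers $1\le k_i\le p-1$, $0\le r_i\le q-1$ such that $$k_i\le\left\lfloor\frac{\sum_{j=1}^{5}k_j-3}{2}\right\rfloor\quad\text{for all } i\in\{1,\ldots,5\}.$$ If the ring $A=k[x_1,\ldots,x_5]/(x_1^{d_1},\ldots,x_5^{d_5})$ has the weak Lefschetz property, then $q=p=3$ and $(d_1,\ldots,d_5)$ is $(4,4,4,4,5)$ or a permutation of it.
   Context: A standard graded algebra $A=\oplus_i A_i$ has the weak Lefschetz property (WLP) if there exists $L\in A_1$ such that the multiplication map $\times L:A_i\to A_{i+1}$ has maximal rank (i.e. is injective or surjective) for every $i$. *)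

(* Defs.v *)
From HB Require Import structures.
From mathcomp Require Import all_boot all_algebra.
From mathcomp Require Import ring_quotient generic_quotient.
From mathcomp Require Import boolp.
From mathcomp Require Import mpoly.

Set Implicit Arguments.
Unset Strict Implicit.
Unset Printing Implicit Defensive.

Import GRing.Theory.
Local Open Scope ring_scope.
Local Open Scope quotient_scope.

Definition infinite_field (K : fieldType) : Prop :=
  forall s : seq K, exists x : K, x \notin s.

(* [A_ i] is the i-th graded piece of the graded ring [A], seen as a subset    *)
(* of [A]; negative degrees are omitted, as multiplication out of a zero       *)
(* component is injective.                                                     *)
Definition weak_Lefschetz_property (A : nzRingType) (A_ : nat -> A -> Prop) :
    Prop :=
  exists L : A, A_ 1%N L /\
    forall i : nat,
      (forall a b : A, A_ i a -> A_ i b -> L * a = L * b -> a = b) \/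
      (forall b : A, A_ i.+1 b -> exists2 a : A, A_ i a & L * a = b).

Definition ideal_gen (R : comNzRingType) (n : nat) (g : 'I_n -> R) : {pred R} :=
  fun f => `[< exists c : 'I_n -> R, f = \sum_(i < n) c i * g i >].

Lemma ideal_genP (R : comNzRingType) (n : nat) (g : 'I_n -> R) (f : R) :
  reflect (exists c : 'I_n -> R, f = \sum_(i < n) c i * g i)
          (f \in ideal_gen g).
Proof. exact: asboolP. Qed.

Section MonomialCompleteIntersection.

Variables (K : fieldType) (n : nat) (d : 'I_n -> nat).

Definition power_ideal : {pred {mpoly K[n]}} :=
  ideal_gen (fun i : 'I_n => 'X_i ^+ d i).

(* Needed because the quotient rings of ring_quotient are nonzero.             *)
Hypothesis d_gt0 : forall i, (0 < d i)%N.

Lemma power_ideal_closed : idealr_closed power_ideal.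
Proof.
split.
- apply/ideal_genP; exists (fun=> 0).
  by rewrite big1 // => i _; rewrite mul0r.
- apply/negP => /ideal_genP[c].
  move/(congr1 (fun f : {mpoly K[n]} => f.@[fun=> 0])).
  rewrite meval1 raddf_sum big1 => [/eqP|i _]; first by rewrite oner_eq0.
  by rewrite /= mevalM rmorphXn /= mevalXU expr0n eqn0Ngt d_gt0 mulr0.
- move=> a u v /ideal_genP[c ->] /ideal_genP[c' ->]; apply/ideal_genP.
  exists (fun i => a * c i + c' i).
  rewrite mulr_sumr -big_split /=.
  by apply: eq_bigr => i _; rewrite mulrDl mulrA.
Qed.

Definition power_idealr : idealr {mpoly K[n]} :=
  HB.pack power_ideal (isIdealr.Build _ power_ideal power_ideal_closed).

(* K[x_1, ..., x_n] / (x_1^(d_1), ..., x_n^(d_n))                              *)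
Definition monomial_ci : comNzRingType := {ideal_quot power_idealr}.

Definition monomial_ci_piece (i : nat) (a : monomial_ci) : Prop :=
  exists2 f : {mpoly K[n]},
    f \is i.-homog & a = \pi_{ideal_quot power_idealr} f.

End MonomialCompleteIntersection.

Arguments weak_Lefschetz_property A A_ : clear implicits.
Arguments monomial_ci K {n} d d_gt0.
Arguments monomial_ci_piece K {n} d d_gt0 i a.

(* Main.v *)
From HB Require Import structures.
Require Import Defs.
From mathcomp Require Import all_boot all_algebra.
From mathcomp Require Import ring_quotient generic_quotient.
From mathcomp Require Import mpoly zify.

Set Implicit Arguments.
Unset Strict Implicit.
Unset Printing Implicit Defensive.

Import GRing.Theory.
Local Open Scope ring_scope.

(** Write A for the quotient ring and D for its socle degree, the sum of the
    [d i - 1].  Two facts make the theorem work.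

    First, A is Gorenstein: every nonzero element has a multiple spanning the
    one-dimensional top degree D.  So if a Lefschetz form L annihilates a
    nonzero class of degree i, then L is not injective in any degree from i to
    D; if moreover [2 * i < D], the weak Lefschetz property makes L surjective
    onto degree [D - i], and the class would be orthogonal to all of degree
    [D - i].  Hence [D <= 2 * i] ([annihilated_degree_ge]), and more generally
    L ^+ N cannot annihilate a nonzero class of degree i unless
    [D <= 2 * (i + N - 1)] ([annihilated_power_degree_ge]).

    Second, in characteristic p the power [L ^+ q] is a linear form in the
    y_i = x_i ^+ q ([linear_form_expE]), so kernel elements of [L ^+ q] come
    from kernel elements of a linear form in a ring with much smaller exponents
    [c i + 1], where [c i] is [k i - 1] or [k i].  In the middle degree j of such a
    ring, where the [c i] sum to [2 * j] and none exceeds j, there is an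
    explicit one.  By Macaulay duality it corresponds to a form annihilated by
    a constant coefficient derivation, and one such form is a product of brackets
    [b_v Y_u - b_u Y_v], one for each edge of a loopless multigraph with vertex
    degrees [c i] ([exists_invariant]).  Because [c i < p], the factorials that
    translate between the two descriptions are invertible
    ([exists_annihilated]).

    For each set S of indices with [r i > 0] and of the right parity one may use the exponents [k i + 1]
    on S and [k i] off S; the degree bound becomes a linear inequality between
    q and the remainders [r i] ([remainder_subset_bound]).  Together these force
    [q <= 6] ([remainder_cases]).  As [L ^+ (p * q) = 0] also bounds D
    ([degree_sum_bound]), only q = p = 3 with all [k i] equal to 1 survives. *)

(** * The ideal generated by powers of the variables *)

Section PowerIdeal.

Variables (K : fieldType) (n : nat) (d : 'I_n -> nat).
Hypothesis d_gt0 : forall i, (0 < d i)%N.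

Local Notation I := (power_idealr K d_gt0).

Lemma monomial_in_ideal (m : 'X_{1..n}) i : (d i <= m i)%N -> 'X_[m] \in I.
Proof.
move=> le_dm; have le_Um : (U_(i) *+ d i <= m)%MM.
  apply/mnm_lepP => j; rewrite mulmnE mnm1E.
  by case: (eqVneq i j) => [<-|_]; rewrite ?mul1n.
rewrite -(submK le_Um) mpolyXD -mpolyXn; apply: idealMr.
apply/ideal_genP; exists (fun j => (j == i)%:R).
by rewrite (bigD1 i) //= eqxx mul1r big1 ?addr0 // => j /negPf->; rewrite mul0r.
Qed.

(** The ideal is spanned by monomials, so membership can be read off the
    coefficients of the standard monomials. *)
Lemma mem_idealP f :
  reflect (forall m : 'X_{1..n}, (forall i, m i < d i)%N -> f@_m = 0) (f \in I).
Proof.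
apply: (iffP idP) => [/ideal_genP[c ->] m m_lt|f0].
  rewrite raddf_sum big1 //= => i _.
  apply: contraTeq (m_lt i); rewrite -mcoeff_msupp -leqNgt mpolyXn.
  rewrite (perm_mem (msuppMX _ _)) => /mapP[m' _ ->].
  by rewrite mnmDE mulmnE mnm1E eqxx mul1n leq_addr.
rewrite (mpolyE f) big_seq; apply: rpred_sum => m m_f.
have [/forallP m_lt|] := boolP [forall i, m i < d i]%N.
  by rewrite f0 ?scale0r ?rpred0.
rewrite negb_forall => /existsP[i]; rewrite -leqNgt => le_dm.
by rewrite -mul_mpolyC idealMr ?(monomial_in_ideal le_dm).
Qed.

Lemma idealZ a f : f \in I -> a *: f \in I.
Proof. by move=> fI; rewrite -mul_mpolyC idealMr. Qed.

(** Lifting the property to polynomials turns every later computation in the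
    quotient into a membership in the ideal. *)
Lemma WLP_polynomial :
  weak_Lefschetz_property (monomial_ci K d d_gt0)
                          (monomial_ci_piece K d d_gt0) ->
  exists2 l : {mpoly K[n]}, l \is 1.-homog &
    forall i,
      (forall f, f \is i.-homog -> l * f \in I -> f \in I) \/
      (forall g, g \is i.+1.-homog -> exists f, g - l * f \in I).
Proof.
case=> L [[l l_homog ->] wlp]; exists l => // i.
pose pi := \pi_({ideal_quot I})%qT : {mpoly K[n]} -> monomial_ci K d d_gt0.
have piE f g : (f - g \in I) = (pi f == pi g) by rewrite Quotient.idealrBE.
have pi0 : pi 0 = 0 by exact: rmorph0.
have piM f g : pi (f * g) = pi f * pi g by exact: rmorphM.
have pi_id f : (f \in I) = (pi f == 0) by rewrite -pi0 -piE subr0.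
case: (wlp i) => [inj|surj]; [left=> f f_i | right=> g g_i].
  rewrite !pi_id piM => /eqP lf0; apply/eqP; rewrite -pi0.
  apply: inj; [by exists f | by exists 0; rewrite ?dhomog0 |].
  by rewrite -/pi lf0 pi0 mulr0.
have [|_ [f _ ->] lf] := surj (pi g); first by exists g.
by exists f; rewrite piE piM -lf.
Qed.

End PowerIdeal.

(** * The degree of a class annihilated by a Lefschetz form *)

Lemma exists_submnm n (w : 'X_{1..n}) k :
  (k <= mdeg w)%N -> exists2 w' : 'X_{1..n}, (w' <= w)%MM & mdeg w' = k.
Proof.
elim: k => [|k IHk] k_le.
  by exists 0%MM; [apply/mnm_lepP => i; rewrite mnm0E | rewrite mdeg0].
have [w' /mnm_lepP le_w' deg_w'] := IHk (ltnW k_le).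
have [/forallP ge_w'|] := boolP [forall i, w i <= w' i]%N.
  suff : (mdeg w <= k)%N by lia.
  by rewrite -deg_w' !mdegE leq_sum.
rewrite negb_forall => /existsP[i]; rewrite -ltnNge => lt_i.
exists (w' + U_(i))%MM; last by rewrite mdegD mdeg1 deg_w' addn1.
apply/mnm_lepP => j; rewrite mnmDE mnm1E.
by case: (eqVneq i j) => [<-|_]; rewrite ?addn1 ?addn0.
Qed.

Section Socle.

Variables (K : fieldType) (n : nat) (d : 'I_n -> nat).
Hypothesis d_gt0 : forall i, (0 < d i)%N.

Local Notation I := (power_idealr K d_gt0).

Variable l : {mpoly K[n]}.
Hypothesis l_homog : l \is 1.-homog.
Hypothesis l_lefschetz : forall i,
  (forall f, f \is i.-homog -> l * f \in I -> f \in I) \/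
  (forall g, g \is i.+1.-homog -> exists f, g - l * f \in I).

(** A standard monomial m of f is completed to the socle monomial by w.  If
    [2 * i < D], some divisor w' of w has degree [D - 2 * i - 1]; the product of f
    by w' refutes injectivity from degree [D - i - 1], and surjectivity there would
    write w as a multiple of l, forcing f * w into the ideal. *)
Lemma annihilated_degree_ge i f :
  f \is i.-homog -> f \notin I -> l * f \in I ->
  (\sum_(k < n) (d k).-1 <= i.*2)%N.
Proof.
move=> f_i fNI lfI; rewrite leqNgt; apply/negP => lt_i.
have [m m_lt fm] : exists2 m : 'X_{1..n},
    (forall k, m k < d k)%N & f@_m != 0.
  have [/hasP[m m_f /forallP m_lt]|/hasPn no_m] :=
      boolP (has (fun m : 'X_{1..n} => [forall k, m k < d k]%N) (msupp f)).
    by exists m; rewrite // -mcoeff_msupp.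
  case/negP: fNI; apply/mem_idealP => m m_lt; apply: contraTeq isT.
  by rewrite -mcoeff_msupp => /no_m/negP[]; apply/forallP.
have deg_m : mdeg m = i by apply: (dhomog_mf f_i); rewrite mcoeff_msupp.
pose w := [multinom (d k).-1 - m k | k < n]%N.
have sum_mw k : (m k + w k)%N = (d k).-1.
  by rewrite mnmE subnKC // -ltnS prednK.
have deg_w : (i + mdeg w)%N = \sum_(k < n) (d k).-1.
  rewrite -deg_m !mdegE -big_split /=.
  by apply: eq_bigr => k _.
rewrite -deg_w in lt_i.
have mul_neq0 w' : (w' <= w)%MM -> f * 'X_[w'] \notin I.
  move=> /mnm_lepP le_w'; apply: contra fm => /mem_idealP fw0.
  rewrite -(mcoeffMX f w' m) addmC fw0 // => k.
  rewrite mnmDE -(prednK (d_gt0 k)) ltnS -sum_mw leq_add2l; exact: le_w'.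
have [|w' le_w' deg_w'] := @exists_submnm n w (mdeg w - i).-1; first by lia.
have deg_w'S : mdeg w = (i + mdeg w').+1 by lia.
case: (l_lefschetz (i + mdeg w')) => [inj|surj].
  have /negP[] := mul_neq0 _ le_w'; apply: inj.
    by apply: dhomogM => //; rewrite dhomogX.
  by rewrite mulrA mulrC idealMr.
have [|a wa] := surj 'X_[w]; first by rewrite dhomogX; apply/eqP.
have /negP[] := mul_neq0 w (lepm_refl _).
rewrite -[_ * _](subrK (a * (l * f))) rpredD //; last exact: idealMr.
have -> : f * 'X_[w] - a * (l * f) = f * ('X_[w] - l * a).
  by rewrite mulrBr [l * a]mulrC [a * (l * f)]mulrA [a * l * f]mulrC.
exact: idealMr.
Qed.

(** The last nonzero power of l times g is annihilated by l, and its degree is at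
    most [i + N]. *)
Lemma annihilated_power_degree_ge i N g :
  g \is i.-homog -> g \notin I -> l ^+ N.+1 * g \in I ->
  (\sum_(k < n) (d k).-1 <= (i + N).*2)%N.
Proof.
elim: N i g => [|N IHN] i g g_i gNI lgI.
  by rewrite addn0; apply: annihilated_degree_ge g_i gNI _; rewrite -[l]expr1.
have [lgI'|lgNI] := boolP (l * g \in I).
  by apply: leq_trans (annihilated_degree_ge g_i gNI lgI') _; lia.
rewrite -addSnnS -add1n; apply: IHN lgNI _; first exact: dhomogM.
by rewrite mulrA -exprSr.
Qed.

End Socle.

(** * Powers of linear forms in characteristic p *)

Section Frobenius.

Variables (K : fieldType) (n p : nat).
Hypothesis p_char : p \in [pchar K].

Lemma linear_form_expE (l : {mpoly K[n]}) e :
  l \is 1.-homog ->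
  l ^+ (p ^ e) = \sum_(i < n) (l@_U_(i) ^+ (p ^ e)) *: 'X_i ^+ (p ^ e).
Proof.
move=> l1; have pM : p \in [pchar {mpoly K[n]}] := rmorph_pchar (@mpolyC n K) p_char.
have p_nat : ([pchar {mpoly K[n]}]).-nat (p ^ e)%N.
  by rewrite (eq_pnat _ (pcharf_eq pM)) pnatX pnat_id ?(pcharf_prime p_char).
have {1}-> : l = \sum_(i < n) l@_U_(i) *: 'X_i.
  apply/mpolyP => m; rewrite raddf_sum /=.
  under eq_bigr do rewrite mcoeffZ mcoeffX.
  have [m1|m_neq1] := eqVneq (mdeg m) 1%N.
    have /existsP[i /eqP->] : [exists i, m == U_(i)%MM] by rewrite -mdeg_eq1 m1.
    rewrite (bigD1 i) //= eqxx mulr1 big1 ?addr0 // => k /negPf ki.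
    by rewrite eq_mnm1 ki mulr0.
  rewrite (dhomog_nemf_coeff l1 m_neq1) big1 // => i _.
  case: eqP => [Um|_]; last by rewrite mulr0.
  by rewrite -Um mdeg1 in m_neq1.
have exp0 : 0 ^+ (p ^ e) = 0 :> {mpoly K[n]}.
  by rewrite expr0n -[_ == _]negbK -lt0n expn_gt0 prime_gt0 ?(pcharf_prime p_char).
rewrite (big_morph _ (fun x y => exprDn_pchar x y p_nat) exp0).
by apply: eq_bigr => i _; rewrite exprZn.
Qed.

End Frobenius.

(** * Forms annihilated by a derivation with constant coefficients *)

Section Brackets.

Variables (K : fieldType) (n : nat) (b : 'I_n -> K).

Definition wderiv (F : {mpoly K[n]}) : {mpoly K[n]} := \sum_i b i *: F^`M(i).

Lemma wderivM F G : wderiv (F * G) = wderiv F * G + F * wderiv G.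
Proof.
rewrite /wderiv mulr_suml mulr_sumr -big_split /=; apply: eq_bigr => i _.
by rewrite mderivM scalerDr scalerAl scalerAr.
Qed.

Lemma wderivX i : wderiv 'X_i = (b i)%:MP.
Proof.
rewrite /wderiv (bigD1 i) //= mderivX mnm1E eqxx scale1r big1 => [|k /negPf ki].
  have -> : (U_(i) - U_(i))%MM = 0%MM :> 'X_{1..n}.
    by apply/mnmP => k; rewrite mnmBE mnm0E subnn.
  by rewrite addr0 mpolyX0 -[RHS]mulr1 mul_mpolyC.
by rewrite mderivX mnm1E eq_sym ki scale0r scaler0.
Qed.

(** The bracket [b_v Y_u - b_u Y_v] is killed by the derivation; it may be
    zero when b_u is, but then Y_u itself is killed. *)
Lemma exists_bracket u v : u != v ->
  exists g : {mpoly K[n]}, [/\ g != 0, g \is 1.-homog, wderiv g = 0 &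
    {in msupp g, forall m : 'X_{1..n}, m = U_(u)%MM \/ m = U_(v)%MM}].
Proof.
move=> uv; have X1 i : 'X_i \is [in K[n], 1.-homog].
  by rewrite dhomogX; apply/eqP/mdeg1.
have [bu0|bu_neq0] := eqVneq (b u) 0.
  exists 'X_u; split=> //; last 1 first.
  - by move=> m; rewrite msuppX inE => /eqP->; left.
  - by rewrite -msupp_eq0 msuppX.
  - by rewrite wderivX bu0 mpolyC0.
exists (b v *: 'X_u - b u *: 'X_v); split.
- apply: contraNneq bu_neq0 => /(congr1 (mcoeff U_(v))).
  rewrite mcoeffB !mcoeffZ !mcoeffXU (negPf uv) eqxx mulr0 mulr1 sub0r mcoeff0.
  by move/eqP; rewrite oppr_eq0.
- by rewrite rpredB ?rpredZ.
- have wZ a F : wderiv (a *: F) = a *: wderiv F.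
    rewrite /wderiv scaler_sumr; apply: eq_bigr => i _.
    by rewrite mderivZ !scalerA mulrC.
  have wB F G : wderiv (F - G) = wderiv F - wderiv G.
    rewrite /wderiv -sumrB; apply: eq_bigr => i _.
    by rewrite mderivB scalerBr.
  by rewrite wB !wZ !wderivX -!mul_mpolyC -!mpolyCM mulrC subrr.
- move=> m; rewrite mcoeff_msupp mcoeffB !mcoeffZ !mcoeffX.
  case: (eqVneq U_(u)%MM m) => [<-|_]; first by left.
  case: (eqVneq U_(v)%MM m) => [<-|_]; first by right.
  by rewrite !mulr0 subrr eqxx.
Qed.

(** A product of brackets over the edges of a multigraph in which vertex i has
    degree [c i].  The graph is built one edge at a time: joining the two vertices
    u and v of largest degree keeps every remaining degree at most half of the new
    total.  This is the construction of SL_2-invariants in a tensor product of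
    the spaces of binary forms of degrees [c i]. *)
Lemma exists_invariant j (c : 'I_n -> nat) :
  (\sum_i c i = j.*2)%N -> (forall i, c i <= j)%N ->
  exists F : {mpoly K[n]}, [/\ F != 0, F \is j.-homog, wderiv F = 0 &
    {in msupp F, forall (m : 'X_{1..n}) i, m i <= c i}%N].
Proof.
elim: j c => [|j IHj] c sum_c le_c.
  exists 1; split; [exact: oner_neq0 | exact: dhomog1 | |].
    by rewrite /wderiv big1 // => i _; rewrite -mpolyC1 mderivC scaler0.
  by move=> m; rewrite msupp1 inE => /eqP-> i; rewrite mnm0E.
have [i0 _|no_index] := pickP (@predT 'I_n); last first.
  by move: sum_c; rewrite big1 // => i; have := no_index i.
case: (arg_maxnP c (isT : xpredT i0)) => u _ max_c {i0}.
have {max_c} max_u i : (c i <= c u)%N by exact: max_c.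
have [i1 i1u] : exists i1, i1 != u.
  apply/existsP; apply: contraTT (le_c u); rewrite negb_exists => /forallP all_u.
  rewrite -ltnNge; move: sum_c; rewrite (bigD1 u) //= big1 => [|i]; first by lia.
  by rewrite (negPf (all_u i)).
case: (@arg_maxnP _ i1 (fun i => i != u) c i1u) => v vu max_c {i1 i1u}.
have {max_c} max_v i : i != u -> (c i <= c v)%N by exact: max_c.
have split_c : (c u + (c v + \sum_(i | (i != u) && (i != v)) c i) = j.+1.*2)%N.
  by rewrite -sum_c [in RHS](bigD1 u) //= [in RHS](bigD1 v).
have cv_gt0 : (0 < c v)%N.
  have [cv0|//] := posnP (c v); move: split_c (le_c u).
  rewrite cv0 big1 => [|i /andP[iu _]]; first by lia.
  by move: (max_v i iu); lia.
have cu_gt0 : (0 < c u)%N by apply: leq_trans cv_gt0 (max_u v).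
pose c' i := (c i - (i == u) - (i == v))%N.
have [||F [F_neq0 F_j DF F_le]] := IHj c'.
- rewrite (bigD1 u) //= (bigD1 v) //=.
  have -> : c' u = (c u).-1 by rewrite /c' eqxx eq_sym (negPf vu); lia.
  have -> : c' v = (c v).-1 by rewrite /c' eqxx (negPf vu); lia.
  have -> : (\sum_(i < n | (i != u) && (i != v)) c' i =
             \sum_(i < n | (i != u) && (i != v)) c i)%N.
    by apply: eq_bigr => i /andP[/negPf iu /negPf iv]; rewrite /c' iu iv !subn0.
  by move: split_c; move: (\sum_(i | _) c i)%N => t; lia.
- move=> i; rewrite /c'; have [->|iu] := eqVneq i u; first by move: (le_c u); lia.
  have [->|iv] := eqVneq i v; first by move: (le_c v); lia.
  move: split_c (max_v i iu) (max_u i).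
  by rewrite (bigD1 i) ?iu //=; lia.
have [|g [g_neq0 g1 Dg g_uv]] := @exists_bracket u v; first by rewrite eq_sym.
exists (g * F); split.
- by rewrite mulf_neq0.
- by rewrite -add1n dhomogM.
- by rewrite wderivM Dg DF mul0r mulr0 addr0.
move=> m /msuppM_le/allpairsP[[m1 m2] /= [m1_g m2_F ->]] i.
have := F_le _ m2_F i; rewrite mnmDE /c'.
case: (g_uv _ m1_g) => ->; rewrite mnm1E !(eq_sym i).
  by case: (eqVneq u i) => [<-|_]; rewrite ?(negPf vu); lia.
by case: (eqVneq v i) => [<-|_]; rewrite -1?(eq_sym v) ?(negPf vu); lia.
Qed.

End Brackets.

(** * Kernel elements of the q-th power of a linear form *)

Section Lift.

Variables (K : fieldType) (n q : nat) (d s c : 'I_n -> nat).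
Hypothesis d_gt0 : forall i, (0 < d i)%N.
Hypothesis lt_d : forall i, (s i + q * c i < d i)%N.
Hypothesis ge_d : forall i, (d i <= s i + q * (c i).+1)%N.

Local Notation I := (power_idealr K d_gt0).

(** The monomial Y ^ m becomes x ^ s times the monomial in the x_i ^ q dual to m
    in the box bounded by c, with the factor m! that turns derivation in Y into
    multiplication by x_i ^ q. *)
Definition lift_mnm (m : 'X_{1..n}) : 'X_{1..n} :=
  [multinom s i + q * (c i - m i) | i < n]%N.

Definition mnm_fact (m : 'X_{1..n}) : nat := (\prod_(i < n) (m i)`!)%N.

(** The sum runs over all monomials of degree below N, not over the support of F,
    so that [lift] is visibly linear. *)
Definition lift (N : nat) (F : {mpoly K[n]}) : {mpoly K[n]} :=
  \sum_(m : 'X_{1..n < N}) (F@_m * (mnm_fact m)%:R) *: 'X_[lift_mnm m].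

Lemma lift_is_linear N : linear (lift N).
Proof.
move=> a F G; rewrite /lift scaler_sumr -big_split /=; apply: eq_bigr => m _.
by rewrite mcoeffD mcoeffZ mulrDl scalerDl scalerA mulrA.
Qed.

HB.instance Definition _ N :=
  GRing.isLinear.Build K {mpoly K[n]} {mpoly K[n]} _ (lift N) (lift_is_linear N).

Lemma liftX N m : (mdeg m < N)%N ->
  lift N 'X_[m] = (mnm_fact m)%:R *: 'X_[lift_mnm m].
Proof.
move=> m_lt; rewrite /lift (bigD1 (BMultinom m_lt)) //= mcoeffX eqxx mul1r.
rewrite big1 ?addr0 // => m' m'm; rewrite mcoeffX.
have -> : (m == m') = false.
  by apply: contraNF m'm => /eqP m_m'; apply/eqP/val_inj.
by rewrite mul0r scale0r.
Qed.

Lemma mnm_factS (m : 'X_{1..n}) i : (0 < m i)%N ->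
  mnm_fact m = (m i * mnm_fact (m - U_(i))%MM)%N.
Proof.
move=> mi_gt0; rewrite /mnm_fact (bigD1 i) //= [in RHS](bigD1 i) //= mulnA.
rewrite mnmBE mnm1E eqxx subn1 -[in LHS](prednK mi_gt0) factS prednK //.
congr (_ * _)%N; apply: eq_bigr => k /negPf ki.
by rewrite mnmBE mnm1E eq_sym ki subn0.
Qed.

(** If [m i = 0], the derivative vanishes, and the product reaches the exponent
    [s i + q * (c i).+1], which is at least [d i]. *)
Lemma lift_mderivX N (m : 'X_{1..n}) i :
  (mdeg m < N)%N -> (m i <= c i)%N ->
  'X_i ^+ q * lift N 'X_[m] - lift N ('X_[m])^`M(i) \in I.
Proof.
move=> m_lt le_mc; rewrite mderivX linearZ /=.
have m'_lt : (mdeg (m - U_(i))%MM < N)%N by apply: leq_ltn_trans m_lt; exact: mdegB.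
rewrite !liftX // -scalerAr mpolyXn -mpolyXD scalerA -natrM.
have [mi0|mi_gt0] := posnP (m i).
  rewrite mi0 mul0n scale0r subr0 idealZ //.
  apply: (@monomial_in_ideal K n d d_gt0 _ i).
  by apply: leq_trans (ge_d i) _; rewrite mnmDE mulmnE mnm1E eqxx mnmE mi0; lia.
rewrite -mnm_factS //.
suff -> : (U_(i) *+ q + lift_mnm m)%MM = lift_mnm (m - U_(i))%MM.
  by rewrite subrr (idealr0 I).
apply/mnmP => k; rewrite mnmDE mulmnE mnm1E !mnmE.
case: (eqVneq i k) => [ik|_]; last by rewrite subn0.
rewrite -ik mul1n subnBA // addn1 subSn // mulnS; lia.
Qed.

Lemma lift_wderiv N (b : 'I_n -> K) F :
  {in msupp F, forall m : 'X_{1..n}, mdeg m < N}%N ->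
  {in msupp F, forall (m : 'X_{1..n}) i, m i <= c i}%N ->
  (\sum_i b i *: 'X_i ^+ q) * lift N F - lift N (wderiv b F) \in I.
Proof.
move=> F_lt F_le; rewrite /wderiv (linear_sum (lift N)) mulr_suml -sumrB.
apply: rpred_sum => i _; rewrite /= -scalerAl (linearZZ (lift N)) -scalerBr idealZ //.
rewrite [F]mpolyE big_seq (linear_sum (mderiv i)) !(linear_sum (lift N)).
rewrite mulr_sumr -sumrB.
apply: rpred_sum => m m_F; rewrite /= mderivZ !(linearZZ (lift N)) -scalerAr -scalerBr.
by rewrite idealZ // lift_mderivX ?F_lt ?F_le.
Qed.

(** The lift of an invariant is nonzero modulo the ideal: its monomials are
    pairwise distinct and standard, and m! is invertible since [m i <= c i < p]. *)
Lemma exists_annihilated p j (b : 'I_n -> K) :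
  p \in [pchar K] -> (forall i, c i < p)%N -> (0 < q)%N ->
  (\sum_i c i = j.*2)%N -> (forall i, c i <= j)%N ->
  exists f : {mpoly K[n]}, [/\ f \is (\sum_i s i + q * j)%N.-homog, f \notin I &
    (\sum_i b i *: 'X_i ^+ q) * f \in I].
Proof.
move=> p_char c_lt q_gt0 sum_c le_c.
have [F [F_neq0 F_j DF F_le]] := exists_invariant b sum_c le_c.
have F_lt : {in msupp F, forall m : 'X_{1..n}, mdeg m < j.+1}%N.
  by move=> m m_F; rewrite ltnS (dhomog_mf F_j).
have liftE : lift j.+1 F =
    \sum_(m <- msupp F) (F@_m * (mnm_fact m)%:R) *: 'X_[lift_mnm m].
  rewrite {1}[F]mpolyE (linear_sum (lift _)) !big_seq; apply: eq_bigr => m m_F.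
  by rewrite (linearZZ (lift _)) /= liftX ?F_lt // scalerA.
exists (lift j.+1 F); split.
- rewrite liftE big_seq; apply: rpred_sum => m m_F; rewrite rpredZ // dhomogX.
  apply/eqP; rewrite /= mdegE; under eq_bigr do rewrite mnmE.
  rewrite big_split -big_distrr /= sumnB => [|i _]; last exact: F_le.
  by rewrite sum_c -mdegE (dhomog_mf F_j) // -addnn addnK.
- have m0_F := mlead_supp F_neq0; set m0 := mlead F in m0_F.
  apply/mem_idealP => /(_ (lift_mnm m0)) lift0.
  have /eqP : (lift j.+1 F)@_(lift_mnm m0) = 0.
    apply: lift0 => i; rewrite mnmE; apply: leq_ltn_trans (lt_d i).
    by rewrite leq_add2l leq_mul2l leq_subr orbT.
  rewrite liftE raddf_sum (bigD1_seq m0) ?msupp_uniq //= mcoeffZ mcoeffX eqxx.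
  rewrite mulr1 big_seq_cond big1 => [|m /andP[m_F m_m0]].
    rewrite addr0 mulf_eq0 mcoeff_eq0 m0_F /=; apply/negP.
    rewrite -(dvdn_pcharf p_char) /mnm_fact.
    have p_pr := pcharf_prime p_char.
    apply: (big_ind (fun N => ~~ (p %| N)%N)) => [|x y px py|i _].
    - by rewrite dvdn1 gtn_eqF ?prime_gt1.
    - by rewrite Euclid_dvdM // negb_or px.
    - have m0_lt : (m0 i < p)%N by apply: leq_ltn_trans (c_lt i); exact: F_le.
      elim: (m0 i) m0_lt => [|N IHN] N_lt; first by rewrite dvdn1 gtn_eqF ?prime_gt1.
      by rewrite factS Euclid_dvdM // negb_or gtnNdvd // IHN // ltnW.
  rewrite mcoeffZ mcoeffX; case: eqP => [/mnmP lift_eq|_]; last by rewrite mulr0.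
  case/eqP: m_m0; apply/mnmP => i; move: (lift_eq i); rewrite !mnmE.
  move/addnI/eqP; rewrite eqn_pmul2l // => /eqP.
  by have := F_le _ m_F i; have := F_le _ m0_F i; lia.
- by have := lift_wderiv b F_lt F_le; rewrite DF (linear0 (lift _)) subr0.
Qed.

End Lift.

(** * Degree bounds implied by the weak Lefschetz property *)

Section DegreeBounds.

Variables (K : fieldType) (n p e : nat) (d : 'I_n -> nat).
Hypothesis p_char : p \in [pchar K].
Hypothesis d_gt0 : forall i, (0 < d i)%N.
Hypothesis wlp : weak_Lefschetz_property (monomial_ci K d d_gt0)
                                         (monomial_ci_piece K d d_gt0).

Local Notation I := (power_idealr K d_gt0).
Local Notation q := (p ^ e)%N.

Let q_gt0 : (0 < q)%N.
Proof. by rewrite expn_gt0 prime_gt0 ?(pcharf_prime p_char). Qed.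

Lemma WLP_lift_bound (s c : 'I_n -> nat) j :
  (forall i, s i + q * c i < d i)%N -> (forall i, d i <= s i + q * (c i).+1)%N ->
  (forall i, c i < p)%N -> (\sum_i c i = j.*2)%N -> (forall i, c i <= j)%N ->
  (\sum_i (d i).-1 <= (\sum_i s i + q * j + q.-1).*2)%N.
Proof.
move=> lt_d ge_d c_lt sum_c le_c; have [l l1 lef] := WLP_polynomial wlp.
have [f [f_homog fNI fI]] := exists_annihilated d_gt0 lt_d ge_d
  (fun i => l@_U_(i) ^+ q) p_char c_lt q_gt0 sum_c le_c.
apply: (annihilated_power_degree_ge l1 lef f_homog fNI).
by rewrite prednK // (linear_form_expE p_char e l1).
Qed.

(** When every [d i] is at most q, the power [l ^+ q] already annihilates 1. *)
Lemma WLP_socle_bound :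
  (forall i, d i <= q)%N -> (\sum_i (d i).-1 <= (q.-1).*2)%N.
Proof.
move=> le_d; have [l l1 lef] := WLP_polynomial wlp.
have := @annihilated_power_degree_ge _ _ _ d_gt0 _ l1 lef 0 q.-1 1; rewrite add0n.
apply; first exact: dhomog1.
  by rewrite idealr1.
rewrite prednK // mulr1 (linear_form_expE p_char e l1).
apply: rpred_sum => i _; apply: idealZ; rewrite mpolyXn.
apply: (@monomial_in_ideal K n d d_gt0 _ i).
by rewrite mulmnE mnm1E eqxx mul1n.
Qed.

End DegreeBounds.

Local Open Scope nat_scope.

(** * The inequalities in five variables *)

Section FiveVariables.

Variables (K : fieldType) (p e : nat) (d k r : 'I_5 -> nat).
Local Notation q := (p ^ e).
Hypothesis p_char : p \in [pchar K]%R.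
Hypothesis d_def : forall i, d i = k i * q + r i.
Hypothesis k_gt0 : forall i, 0 < k i.
Hypothesis k_lt : forall i, k i < p.
Hypothesis r_lt : forall i, r i < q.
Hypothesis k_sum : forall i, (k i).*2 + 3 <= \sum_j k j.
Hypothesis d_gt0 : forall i, 0 < d i.
Hypothesis wlp : weak_Lefschetz_property (monomial_ci K d d_gt0)
                                         (monomial_ci_piece K d d_gt0).

Let sum1_5 : \sum_(i < 5) 1 = 5.
Proof. by rewrite sum1_card card_ord. Qed.

Let sum_d : \sum_i (d i).-1 + 5 = q * \sum_i k i + \sum_i r i.
Proof.
rewrite -[X in _ + X = _]sum1_5 big_distrr -!big_split /=; apply: eq_bigr => i _.
by rewrite addn1 prednK // d_def mulnC.
Qed.

(** On S the shift is 0 and the exponent of y_i is [k i + 1]; off S the shift is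
    [r i] and the exponent is [k i].  The parity condition says that the box has a
    middle degree, and [k_sum] that no side of it exceeds half of the total. *)
Lemma remainder_subset_bound (S : pred 'I_5) :
  (forall i, S i -> 0 < r i) -> odd (\sum_i k i + \sum_i S i) ->
  3 * q + 2 * (\sum_(i | S i) r i) <= \sum_i r i + q * (\sum_i S i) + 3.
Proof.
move=> S_gt0 odd_kS.
pose c i := (k i).-1 + S i; pose s i := if S i then 0 else r i.
have sum_c : \sum_i c i + 5 = \sum_i k i + \sum_i S i.
  rewrite -[X in _ + X = _]sum1_5 -!big_split /=; apply: eq_bigr => i _.
  by rewrite /c addnAC addn1 prednK.
have sum_r : \sum_i r i = \sum_(i | S i) r i + \sum_i s i.
  rewrite (bigID S) /=; congr (_ + _); rewrite [LHS]big_mkcond.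
  by apply: eq_bigr => i _; rewrite /s; case: (S i).
pose j := (\sum_i c i)./2.
have c_even : \sum_i c i = j.*2 by rewrite /j; lia.
have le_c i : c i <= j.
  have := k_sum i; have := k_gt0 i; rewrite /c.
  have : S i <= \sum_i S i by rewrite (bigD1 i) //= leq_addr.
  by case: (S i); lia.
have q_gt0 : 0 < q := leq_ltn_trans (leq0n _) (r_lt ord0).
have bound : \sum_i (d i).-1 <= (\sum_i s i + q * j + q.-1).*2.
  apply: (WLP_lift_bound p_char wlp) c_even le_c => i; rewrite /s /c ?d_def;
    have := k_gt0 i; have := k_lt i; have := r_lt i; have := S_gt0 i;
    case: (S i); rewrite ?addn0 ?addn1 /=; nia.
have : q * (\sum_i c i + 5) = q * (\sum_i k i + \sum_i S i) by rewrite sum_c.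
by rewrite c_even; move: bound sum_d; lia.
Qed.

(** This replaces the case of the empty S when the sum of the [k i] is even, where
    the box with sides [k i - 1] has no middle degree.  One side, of length at
    least 1, is shortened by one, and the shift absorbs the missing factor
    x_v ^ q. *)
Lemma remainder_even_bound : ~~ odd (\sum_i k i) -> 2 * q <= \sum_i r i + 3.
Proof.
move=> even_k.
have [v kv_gt1] : exists v, 1 < k v.
  apply/existsP; apply: contraNT even_k; rewrite negb_exists => /forallP k_le1.
  rewrite (eq_bigr (fun=> 1)) ?sum1_5 // => i _.
  by have := k_le1 i; have := k_gt0 i; lia.
pose c i := (k i).-1 - (i == v); pose s i := r i + q * (i == v).
have sum_v (F : 'I_5 -> nat) : \sum_i F i * (i == v) = F v.
  by rewrite (bigD1 v) //= eqxx muln1 big1 ?addn0 // => i /negPf->; rewrite muln0.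
have sum_c : \sum_i c i + 6 = \sum_i k i.
  have sum6 : \sum_(i < 5) (1 + 1 * (i == v)) = 6.
    by rewrite big_split /= (sum_v (fun=> 1)) sum1_5.
  rewrite -[X in _ + X = _]sum6 -big_split /=; apply: eq_bigr => i _.
  by rewrite /c; case: (eqVneq i v) (k_gt0 i) kv_gt1 => [->|_] /=; lia.
have sum_s : \sum_i s i = \sum_i r i + q by rewrite big_split /= (sum_v (fun=> q)).
pose j := (\sum_i c i)./2.
have c_even : \sum_i c i = j.*2 by rewrite /j; lia.
have le_c i : c i <= j by have := k_sum i; rewrite /c; lia.
have q_gt0 : 0 < q := leq_ltn_trans (leq0n _) (r_lt ord0).
have bound : \sum_i (d i).-1 <= (\sum_i s i + q * j + q.-1).*2.
  apply: (WLP_lift_bound p_char wlp) c_even le_c => i; rewrite /s /c ?d_def;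
    have := k_gt0 i; have := k_lt i; have := r_lt i;
    case: (eqVneq i v) kv_gt1 => [->|_] /=; nia.
have : q * (\sum_i c i + 6) = q * \sum_i k i by rewrite sum_c.
by rewrite c_even; move: bound sum_d; rewrite sum_s; lia.
Qed.

(** Since [d i <= p * q], the power [L ^+ (p * q)] is zero. *)
Lemma degree_sum_bound : q * \sum_i k i + \sum_i r i <= 2 * p * q + 3.
Proof.
have : \sum_i (d i).-1 <= ((p ^ e.+1).-1).*2.
  apply: (WLP_socle_bound p_char wlp) => i; rewrite d_def expnS.
  by have := k_lt i; have := r_lt i; nia.
have : 0 < p ^ e.+1 by rewrite expn_gt0 (leq_ltn_trans (leq0n _) (k_lt ord0)).
by move: sum_d; rewrite expnS; lia.
Qed.

End FiveVariables.

(** * Solving the inequalities *)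

(** Here b is the parity of the sum of the [k i], and the booleans [s0], ..., [s4]
    encode the set S.  Suppose all remainders are positive.  If b holds, adding
    the inequalities of the sets of size 4 gives [3 * R <= 5 * q + 15], while the
    empty set gives [3 * q <= R + 3].  Otherwise the sets of size 3 give [R <= 15]
    and the singletons give [10 * q <= 3 * R + 15].  Both times [q <= 6].  Zero
    remainders leave fewer sets, so the proof branches on which remainders
    vanish and leaves each branch to linear arithmetic. *)
Lemma remainder_cases q r0 r1 r2 r3 r4 (b : bool) :
  let R := r0 + r1 + r2 + r3 + r4 in
  1 < q -> r0 < q -> r1 < q -> r2 < q -> r3 < q -> r4 < q ->
  (~~ b -> 2 * q <= R + 3) ->
  (forall s0 s1 s2 s3 s4 : bool,
     s0 ==> (0 < r0) -> s1 ==> (0 < r1) -> s2 ==> (0 < r2) ->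
     s3 ==> (0 < r3) -> s4 ==> (0 < r4) ->
     b (+) s0 (+) s1 (+) s2 (+) s3 (+) s4 ->
     3 * q + 2 * ((if s0 then r0 else 0) + (if s1 then r1 else 0) +
                  (if s2 then r2 else 0) + (if s3 then r3 else 0) +
                  (if s4 then r4 else 0)) <=
     R + q * (s0 + s1 + s2 + s3 + s4) + 3) ->
  [/\ q != 5, q <= 6, 3 <= R &
      q = 3 -> if b then 6 <= R /\
                 (R = 6 -> perm_eq [:: r0; r1; r2; r3; r4] [:: 1; 1; 1; 1; 2])
               else 3 < R].
Proof.
move=> R q_gt1 lt0 lt1 lt2 lt3 lt4 R_even; rewrite {}/R in R_even *.
case: b R_even => R_even.
all: have [z0|p0] := posnP r0; have [z1|p1] := posnP r1.
all: have [z2|p2] := posnP r2; have [z3|p3] := posnP r3.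
all: have [z4|p4] := posnP r4; move=> /= H.
all: repeat match goal with H : forall s : bool, _ |- _ =>
    move: (H true) (H false); clear H; rewrite /=; move=> ? ? end.
all: split; try lia; move=> q3; try split; try lia.
(* Only the branch with all remainders positive and b true is left. *)
move=> R6; rewrite {}q3 in lt0 lt1 lt2 lt3 lt4.
have {lt0}[e0|e0] : r0 = 1 \/ r0 = 2 by lia.
all: have {lt1}[e1|e1] : r1 = 1 \/ r1 = 2 by lia.
all: have {lt2}[e2|e2] : r2 = 1 \/ r2 = 2 by lia.
all: have {lt3}[e3|e3] : r3 = 1 \/ r3 = 2 by lia.
all: have {lt4}[e4|e4] : r4 = 1 \/ r4 = 2 by lia.
all: move: R6; rewrite e0 e1 e2 e3 e4; by [].
Qed.

Lemma small_prime_power p e :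
  prime p -> 1 < p ^ e <= 6 -> p ^ e != 5 ->
  [\/ p ^ e = 2 /\ p = 2, p ^ e = 4 /\ p = 2 | p ^ e = 3 /\ p = 3].
Proof.
move=> p_pr /andP[q_gt1 q_le6] q_neq5.
have e_lt : e <= 5.
  by rewrite -ltnS; apply: leq_trans (ltn_expl _ (prime_gt1 p_pr)) q_le6.
have e_gt0 : 0 < e by case: (e) q_gt1; rewrite ?expn0.
have p_le : p <= 6.
  by apply: leq_trans q_le6; rewrite -{1}[p]expn1 leq_exp2l ?prime_gt1.
move: p_pr q_gt1 q_le6 q_neq5.
case: p p_le => [|[|[|[|[|[|[|]]]]]]] // _;
  case: e e_lt e_gt0 => [|[|[|[|[|[|]]]]]] //= _ _ _ _ _ _;
  by [constructor 1 | constructor 2 | constructor 3].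
Qed.

Theorem proposition5p6
  (K : fieldType) (K_infinite : infinite_field K)
  (p : nat) (p_char : p \in [pchar K]%R)
  (q e : nat) (q_def : q = p ^ e) (q_gt1 : 1 < q)
  (d k r : 'I_5 -> nat)
  (d_def : forall i, d i = k i * q + r i)
  (k_bound : forall i, 1 <= k i <= p - 1)
  (r_bound : forall i, 0 <= r i <= q - 1)
  (k_sum : forall i, k i <= (\sum_(j < 5) k j - 3) %/ 2)
  (d_gt0 : forall i, 0 < d i)
  (A_WLP : weak_Lefschetz_property
             (monomial_ci K d d_gt0) (monomial_ci_piece K d d_gt0)) :
  (q = p /\ p = 3) /\
  perm_eq [seq d i | i : 'I_5] [:: 4; 4; 4; 4; 5].
Proof.
have p_pr : prime p := pcharf_prime p_char.
have k_gt0 i : 0 < k i by have /andP[] := k_bound i.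
have k_lt i : k i < p by have := k_bound i; have := prime_gt0 p_pr; lia.
have r_lt i : r i < q by have := r_bound i; lia.
have k_sum' i : (k i).*2 + 3 <= \sum_j k j.
  have := k_gt0 i; have := k_sum i; rewrite leq_divRL //.
  by move: (\sum_(j < 5) k j) => T; lia.
rewrite q_def in q_gt1 d_def r_lt *.
have subset_bound :=
  remainder_subset_bound p_char d_def k_gt0 k_lt r_lt k_sum' A_WLP.
have even_bound :=
  remainder_even_bound p_char d_def k_gt0 k_lt r_lt k_sum' A_WLP.
have sum_bound := degree_sum_bound p_char d_def k_lt r_lt A_WLP.
have sum5 (F : 'I_5 -> nat) : \sum_i F i =
    F (inord 0) + F (inord 1) + F (inord 2) + F (inord 3) + F (inord 4).
  rewrite !big_ord_recr big_ord0 /= add0n.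
  by do !congr (_ + _); congr F; apply/val_inj; rewrite /= inordK.
have image5 (F : 'I_5 -> nat) : [seq F i | i : 'I_5] =
    [:: F (inord 0); F (inord 1); F (inord 2); F (inord 3); F (inord 4)].
  have enum5 : map val (enum 'I_5) = [:: 0; 1; 2; 3; 4] by rewrite val_enum_ord.
  rewrite /image_mem; have -> : enum 'I_5 = map inord [:: 0; 1; 2; 3; 4].
    rewrite -enum5 -map_comp -[LHS]map_id; apply: eq_map => i.
    by rewrite /= inord_val.
  by [].
have forall5 (P : 'I_5 -> Prop) : P (inord 0) -> P (inord 1) -> P (inord 2) ->
    P (inord 3) -> P (inord 4) -> forall i, P i.
  by move=> ? ? ? ? ? i; rewrite -[i]inord_val; case: i => [[|[|[|[|[|?]]]]] ?].
have [||q_neq5 q_le6 R_ge3 R_q3] := @remainder_cases (p ^ e)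
  (r (inord 0)) (r (inord 1)) (r (inord 2)) (r (inord 3)) (r (inord 4))
  (odd (\sum_i k i)) q_gt1 (r_lt _) (r_lt _) (r_lt _) (r_lt _) (r_lt _).
- by rewrite -sum5.
- move=> s0 s1 s2 s3 s4 S0 S1 S2 S3 S4 parity.
  pose S : pred 'I_5 := fun i => nth false [:: s0; s1; s2; s3; s4] i.
  have := subset_bound S; rewrite [\sum_(i | S i) _]big_mkcond /=.
  rewrite (sum5 (fun i => if S i then r i else 0)) (sum5 S) (sum5 r) /S !inordK //=; apply.
    by apply: forall5; rewrite inordK //=; exact/implyP.
  by rewrite oddD !(oddD, oddb) !addbA in parity *.
rewrite -sum5 in R_ge3 R_q3.
have k_ge5 : 5 <= \sum_i k i.
  rewrite sum5; move: (k_gt0 (inord 0)) (k_gt0 (inord 1)) (k_gt0 (inord 2)).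
  by move: (k_gt0 (inord 3)) (k_gt0 (inord 4)); lia.
have q_range : 1 < p ^ e <= 6 by rewrite q_gt1.
have [[q2 p2]|[q4 p2]|[q3 p3]] := small_prime_power p_pr q_range q_neq5.
(* For p = 2 the bounds R >= 3 and sum k >= 5 exceed the socle bound. *)
- by move: sum_bound; rewrite q2 p2; lia.
- by move: sum_bound; rewrite q4 p2; lia.
have := R_q3 q3; move: sum_bound; rewrite q3 p3.
have [odd_k|even_k] := boolP (odd (\sum_i k i)); last by move: even_k; lia.
move=> sum_bound [R_ge6 R6].
have k1 i : k i = 1 by have := k_sum' i; have := k_gt0 i; lia.
have {R6} r_perm := R6 ltac:(lia); split=> //; rewrite image5 !d_def !k1 q3 mul1n.
by move/(perm_map (addn 3)): r_perm.
Qed.
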